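(* Let $\mathcal{F}$ be the folded component (with vertex set $\{0,1,\dots,\mathrm{ord}(\ell)-1\}$ and edges as specified in the context). Let $v\in V(\mathcal{F})\setminus\{0\}$ be such that $2\mid v$. Then $$\mathrm{ecc}(v)=\begin{cases}\frac12 v+1 & \text{if } v\ge\frac12(\mathrm{ord}(\ell)+1),\\ \frac12(\mathrm{ord}(\ell)-v+3) & \text{if } v<\frac12(\mathrm{ord}(\ell)+1).\end{cases}$$
   Context: Let $p$ be a prime with $p\equiv 71$ or $119\pmod{120}$, let $\ell=2$, and let $\mathrm{ord}(\ell)$ be the order, in the ideal class group of $\mathbb{Q}(\sqrt{-p})$, of a prime ideal above $2$; it is an odd integer $\ge 3$. The folded component $\mathcal{F}$ (a component of the supersingular $2$-isogeny graph over $\mathbb{F}_p$ after identifying curves up to $\overline{\mathbb{F}_p}$-isomorphism, regarded as a simple undirected graph) is labelled so that $V(\mathcal{F})=\{0,1,\dots,\mathrm{ord}(\ell)-1\}$ and $$E(\mathcal{F})=\{\{2k-1,2k+1\}: 1\le k\le \tfrac12(\mathrm{ord}(\ell)-3)\}\cup\{\{2k+1,2k+2\}:0\le k\le \tfrac12(\mathrm{ord}(\ell)-3)\}\cup\{\{0,1\}\}.$$ The eccentricity $\mathrm{ecc}(v)$ is the maximum graph distance from $v$ to any vertex of $\mathcal{F}$. *)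

(* Defs.v *)
From HB Require Import structures.
From mathcomp Require Import all_boot all_order all_algebra all_field.
Set Implicit Arguments.
Unset Strict Implicit.
Unset Printing Implicit Defensive.
Import Order.TTheory GRing.Theory Num.Theory.
Local Open Scope ring_scope.

Definition Qsqrt_opp (p : nat) (z : algC) : Prop :=
  exists a b : rat, z = ratr a + ratr b * sqrtC (- p%:R).

Definition ring_of_integers (p : nat) (z : algC) : Prop :=
  Qsqrt_opp p z /\ z \in Aint.

(* Closure under opposite follows from stability under multiplication by -1. *)
Definition is_ideal (p : nat) (I : algC -> Prop) : Prop :=
  [/\ forall x, I x -> ring_of_integers p x,
      I 0,
      forall x y, I x -> I y -> I (x + y)
    & forall a x, ring_of_integers p a -> I x -> I (a * x)].

Definition is_prime_ideal (p : nat) (I : algC -> Prop) : Prop :=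
  [/\ is_ideal p I,
      ~ I 1
    & forall x y, ring_of_integers p x -> ring_of_integers p y ->
        I (x * y) -> I x \/ I y].

(* P lies above the rational prime l: P contains l. *)
Definition prime_ideal_above (p l : nat) (P : algC -> Prop) : Prop :=
  is_prime_ideal p P /\ P l%:R.

Definition ideal_mul (I J : algC -> Prop) (z : algC) : Prop :=
  exists (m : nat) (x y : 'I_m -> algC),
    (forall i, I (x i) /\ J (y i)) /\ z = \sum_(i < m) x i * y i.

Definition ideal_exp (p : nat) (I : algC -> Prop) (m : nat) : algC -> Prop :=
  iter m (ideal_mul I) (ring_of_integers p).

Definition ideal_scale (a : algC) (I : algC -> Prop) (z : algC) : Prop :=
  exists2 x, I x & z = a * x.

(* I and J have the same class in the ideal class group: a I = b J for some
   nonzero algebraic integers a, b of Q(sqrt(-p)). *)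
Definition same_ideal_class (p : nat) (I J : algC -> Prop) : Prop :=
  exists a b : algC,
    [/\ ring_of_integers p a, ring_of_integers p b, a != 0, b != 0
      & forall z, ideal_scale a I z <-> ideal_scale b J z].

Definition is_class_order (p : nat) (I : algC -> Prop) (n : nat) : Prop :=
  [/\ (0 < n)%N,
      same_ideal_class p (ideal_exp p I n) (ring_of_integers p)
    & forall m : nat, (0 < m < n)%N ->
        ~ same_ideal_class p (ideal_exp p I m) (ring_of_integers p)].

Local Open Scope nat_scope.

(* Length of a shortest walk from u to w; since shortest walks have fewer than
   #|T| edges, the value #|T| stands for an infinite distance. *)
Definition gdist (T : finType) (e : rel T) (u w : T) : nat :=
  find (fun k => [exists s : k.-tuple T, path e u s && (last u s == w)])
       (iota 0 #|T|).

Definition ecc (T : finType) (e : rel T) (u : T) : nat :=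
  \max_(w : T) gdist e u w.

(* One ordered representative per undirected edge; n is ord(l), meant to be odd
   and at least 3. The two comprehensions range over 1 <= k <= (n - 3)/2 and
   0 <= k <= (n - 3)/2. *)
Definition folded_edges (n : nat) : seq (nat * nat) :=
  [seq (2 * k - 1, 2 * k + 1) | k <- index_iota 1 ((n - 3)./2).+1]
    ++ [seq (2 * k + 1, 2 * k + 2) | k <- index_iota 0 ((n - 3)./2).+1]
    ++ [:: (0, 1)].

Definition folded (n : nat) : rel 'I_n := fun u w =>
  ((u : nat, w : nat) \in folded_edges n)
  || ((w : nat, u : nat) \in folded_edges n).

(* Main.v *)
(* The graph is a caterpillar: the spine is the path 1 - 3 - ... - (n - 2), the
   vertex 2k + 1 carries the leaf 2k + 2, and 1 carries the additional leaf 0.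
   The distance from a leaf v to another vertex w is thus 1, plus the distance
   between the spine vertices to which they are attached, plus 1 if w is a leaf.
   It is largest at one of the two extreme leaves 0 and n - 1. *)
Require Import Defs.
From mathcomp Require Import all_boot all_order all_algebra all_field.
From mathcomp Require Import zify.
Local Open Scope nat_scope.

Section Distance.

Variables (T : finType) (e : rel T) (u : T) (f : T -> nat).
Hypothesis f_source : f u = 0.
Hypothesis f_edge : forall x y, e x y -> f y <= (f x).+1.
Hypothesis f_pred : forall y, y != u -> exists2 x, e x y & f y = (f x).+1.

Lemma potential_le_walk x s : path e x s -> f (last x s) <= f x + size s.
Proof.
elim: s x => [|y s IHs] x /=; first by rewrite addn0.
case/andP=> /f_edge le_yx /IHs le_s.
by apply: leq_trans le_s _; rewrite addnS -addSn leq_add2r.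
Qed.

(** Predecessors given by [f_pred] are followed back from [w]. The potential falls by one each time,
    and it can vanish only at [u], since [f_pred] makes it positive elsewhere. *)
Lemma walk_of_potential_size w :
  exists s, [/\ path e u s, last u s = w & size s = f w].
Proof.
move: {2}(f w) (erefl (f w)) => k; elim: k w => [|k IHk] w fw.
  case: (eqVneq w u) => [->|/f_pred [x _]]; last by rewrite fw.
  by exists [::].
case: (eqVneq w u) => [w_u|/f_pred [x exw]].
  by rewrite w_u f_source in fw.
rewrite fw => -[fx]; have [s [us sx sz]] := IHk x (esym fx).
exists (rcons s w); split; first by rewrite rcons_path us sx.
  by rewrite last_rcons.
by rewrite size_rcons sz fx.
Qed.

(** No walk to [w] is shorter than [f w], because each edge raises [f] by at most one, and descent
    along [f_pred] yields a walk of exactly this length. The bound by [#|T|] keeps that length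
    within the range searched by [gdist]. *)
Lemma gdist_potential w : f w < #|T| -> gdist e u w = f w.
Proof.
move=> fw_lt; rewrite /gdist; set p := (X in find X _).
have p_fw : p (f w).
  have [s [us sw sz]] := walk_of_potential_size w.
  move/eqP: sz => sz; apply/existsP; exists (Tuple sz).
  by rewrite /= us sw eqxx.
have p_ge k : p k -> f w <= k.
  case/existsP=> s /andP[us /eqP <-].
  by have := potential_le_walk _ _ us; rewrite f_source size_tuple.
have has_p : has p (iota 0 #|T|).
  by apply/hasP; exists (f w); rewrite // mem_iota.
have find_lt : find p (iota 0 #|T|) < #|T|
    by rewrite -{2}(size_iota 0 #|T|) -has_find.
apply/eqP; rewrite eqn_leq; apply/andP; split; last first.
  by apply: p_ge; have := nth_find 0 has_p; rewrite nth_iota.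
rewrite leqNgt; apply/negP => /(before_find 0).
by rewrite nth_iota // add0n p_fw.
Qed.

End Distance.

(** This is the infinite caterpillar, with edges oriented towards the larger label. Bounding the
    larger endpoint therefore suffices to cut out the finite graph. *)
Variant caterpillar_edge : nat -> nat -> Prop :=
| RootEdge : caterpillar_edge 0 1
| SpineEdge i : caterpillar_edge i.*2.+1 i.*2.+3
| LeafEdge i : caterpillar_edge i.*2.+1 i.*2.+2.

Variant vertex_spec : nat -> Prop :=
| Root : vertex_spec 0
| Spine i : vertex_spec i.*2.+1
| Leaf i : vertex_spec i.*2.+2.

Lemma vertexP w : vertex_spec w.
Proof.
case: w => [|w]; first exact: Root.
by rewrite -(odd_double_half w); case: (odd w); [apply: Leaf | apply: Spine].
Qed.

Lemma folded_edgesP m a b : b < m.*2.+3 ->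
  reflect (caterpillar_edge a b) ((a, b) \in folded_edges m.*2.+3).
Proof.
rewrite /folded_edges !subSS subn0 doubleK !mem_cat mem_seq1 => b_lt.
apply: (iffP or3P) => [[/mapP | /mapP | /eqP[-> ->]]|].
(* The index 0, at which [2 * k - 1] would be truncated, is outside the range. *)
- case=> -[|k]; first by rewrite mem_index_iota.
  rewrite mem_index_iota => _ [-> ->]; rewrite mul2n doubleS addn1 subn1.
  exact: SpineEdge.
- case=> k _ [-> ->]; rewrite mul2n addn1 addn2.
  exact: LeafEdge.
- exact: RootEdge.
move=> ab; case: ab b_lt => [|i|i] b_lt.
- by apply: Or33.
- apply: Or31; apply/mapP; exists i.+1; last first.
    by rewrite mul2n doubleS addn1 subn1.
  by move: b_lt; rewrite mem_index_iota !ltnS ltn_double.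
- apply: Or32; apply/mapP; exists i; last by rewrite mul2n addn1 addn2.
  by move: b_lt; rewrite mem_index_iota !ltnS leq_double.
Qed.

Lemma foldedP m (u w : 'I_m.*2.+3) :
  reflect (caterpillar_edge u w \/ caterpillar_edge w u) (folded u w).
Proof. by apply: (iffP orP) => -[/folded_edgesP|/folded_edgesP]; auto. Qed.

(* Distance from the leaf [j.*2.+2]: [(w.-1)./2] is the index of the spine
   vertex at or next to [w], truncation at [w = 0] giving the right value. *)
Definition leaf_dist (j w : nat) : nat :=
  if w == j.*2.+2 then 0 else
    ((w.-1)./2 - j) + (j - (w.-1)./2) + (~~ odd w).+1.

Lemma leaf_dist_root j : leaf_dist j 0 = j.+2.
Proof. by rewrite /leaf_dist /= subn0 addn2. Qed.

Lemma leaf_dist_spine j i : leaf_dist j i.*2.+1 = (i - j + (j - i)).+1.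
Proof.
rewrite /leaf_dist /= doubleK odd_double /= addn1 eqSS.
by case: eqP => // /(congr1 odd); rewrite /= !odd_double.
Qed.

Lemma leaf_dist_leaf j i :
  leaf_dist j i.*2.+2 = if i == j then 0 else (i - j + (j - i)).+2.
Proof.
rewrite /leaf_dist !eqSS (inj_eq double_inj) /= uphalf_double odd_double.
by rewrite /= addn2.
Qed.

(** Both inequalities are wanted because [folded] allows each edge to be walked in either
    direction. *)
Lemma leaf_dist_edge j x y : caterpillar_edge x y ->
  leaf_dist j y <= (leaf_dist j x).+1 /\ leaf_dist j x <= (leaf_dist j y).+1.
Proof.
case=> [|i|i].
- rewrite leaf_dist_root (leaf_dist_spine j 0) sub0n subn0; lia.
- rewrite (leaf_dist_spine j i.+1) leaf_dist_spine; lia.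
- rewrite leaf_dist_leaf leaf_dist_spine; case: eqP => [->|_].
    by rewrite subnn.
  by split=> //; rewrite ltnS -addn2 leq_addr.
Qed.

(** The witness is the next vertex on the way to the leaf [j.*2.+2]: a leaf or the root moves to its
    spine vertex, a spine vertex moves along the spine towards index [j], and from there to the
    leaf. *)
Lemma leaf_dist_pred m j y : j <= m -> y < m.*2.+3 -> y != j.*2.+2 ->
  exists x, [/\ x < m.*2.+3, caterpillar_edge x y \/ caterpillar_edge y x
              & leaf_dist j y = (leaf_dist j x).+1].
Proof.
move=> j_le; case: (vertexP y) => [|i|i] y_lt y_neq.
- exists 1; split=> //; first by right; exact: RootEdge.
  by rewrite leaf_dist_root (leaf_dist_spine j 0) sub0n subn0.
- have [i_lt|j_lt|i_j] := ltngtP i j.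
  + exists i.+1.*2.+1; split.
    * by rewrite doubleS !ltnS ltn_double (leq_trans i_lt).
    * by right; rewrite doubleS; exact: SpineEdge.
    * by rewrite !leaf_dist_spine; lia.
  + case: i y_lt {y_neq} j_lt => [//|i] y_lt j_lt; exists i.*2.+1; split.
    * by apply: ltn_trans y_lt; rewrite doubleS !ltnS leqnSn.
    * by left; rewrite doubleS; exact: SpineEdge.
    * by rewrite !leaf_dist_spine; lia.
  + rewrite {}i_j in y_lt *; exists j.*2.+2; split.
    * by rewrite !ltnS leq_double.
    * by right; exact: LeafEdge.
    * by rewrite leaf_dist_spine leaf_dist_leaf eqxx subnn.
- exists i.*2.+1; split; first exact: ltnW.
    by left; exact: LeafEdge.
  move: y_neq; rewrite !eqSS (inj_eq double_inj) leaf_dist_leaf leaf_dist_spine.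
  by move=> /negPf->.
Qed.

Lemma gdist_folded m j (v w : 'I_m.*2.+3) : v = j.*2.+2 :> nat ->
  gdist (@folded m.*2.+3) v w = leaf_dist j w.
Proof.
move=> v_j; have j_le : j <= m.
  by have := ltn_ord v; rewrite v_j !ltnS leq_double.
apply: (@gdist_potential _ _ _ (fun x : 'I_(m.*2.+3) => leaf_dist j x)).
- by rewrite v_j leaf_dist_leaf eqxx.
- by move=> x y /foldedP[] /(leaf_dist_edge j)[].
- move=> y; rewrite -val_eqE /= v_j => y_v.
  have [x [x_lt xy dist_y]] := leaf_dist_pred _ _ _ j_le (ltn_ord y) y_v.
  by exists (Ordinal x_lt) => //; apply/foldedP.
(* All distances are at most [m.+2], which is below the number [m.*2.+3] of vertices. *)
- have := ltn_ord w; rewrite card_ord.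
  case: (vertexP w) => [|i|i]; rewrite !ltnS ?ltn_double ?leq_double => i_le.
  + by rewrite leaf_dist_root; lia.
  + by rewrite leaf_dist_spine; lia.
  + by rewrite leaf_dist_leaf; case: eqP => // _; lia.
Qed.

Lemma ecc_folded m j (v : 'I_m.*2.+3) : v = j.*2.+2 :> nat ->
  ecc (@folded m.*2.+3) v = (maxn j (m - j)).+2.
Proof.
move=> v_j; have j_le : j <= m.
  by have := ltn_ord v; rewrite v_j !ltnS leq_double.
apply/eqP; rewrite eqn_leq; apply/andP; split.
  apply/bigmax_leqP => w _; rewrite (gdist_folded _ _ _ _ v_j).
  have := ltn_ord w.
  case: (vertexP w) => [|i|i]; rewrite !ltnS ?ltn_double ?leq_double => i_le.
  + by rewrite leaf_dist_root !ltnS leq_maxl.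
  + by rewrite leaf_dist_spine; clear - i_le j_le; lia.
  + by rewrite leaf_dist_leaf; case: eqP => // _; clear - i_le j_le; lia.
(* The maximum is attained at the root if [m - j <= j], and at the last leaf [m.*2.+2] otherwise. *)
have [m_le|j_lt] := leqP (m - j) j.
  apply: leq_trans (leq_bigmax (@Ordinal m.*2.+3 0 isT)).
  by rewrite (gdist_folded _ _ _ _ v_j) leaf_dist_root.
have m_lt : m.*2.+2 < m.*2.+3 by [].
apply: leq_trans (leq_bigmax (Ordinal m_lt)).
(* From [j < m - j] follows [j < m], so the last leaf is not [v] itself. *)
rewrite (gdist_folded _ _ _ _ v_j) leaf_dist_leaf gtn_eqF ?leq_addr //.
by rewrite -subn_gt0 (leq_ltn_trans _ j_lt).
Qed.

Theorem proposition27 (p : nat) (p_prime : prime p)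
    (p_mod : p = 71 %[mod 120] \/ p = 119 %[mod 120])
    (P : algC -> Prop) (P_above2 : prime_ideal_above p 2 P)
    (n : nat) (ordP : is_class_order p P n) (n_odd : odd n) (n_ge3 : 3 <= n)
    (v : 'I_n) (v_neq0 : (v : nat) <> 0) (v_even : 2 %| v) :
  ecc (@folded n) v =
    if (n + 1)./2 <= v then v./2 + 1 else (n - v + 3)./2.
Proof.
(* Here [vertexP] serves as a parity analysis of the number [n]. *)
have [m n_m] : exists m, n = m.*2.+3.
  move: n_odd n_ge3; case: (vertexP n) => [|[|m]|i] //=; first by exists m.
  by rewrite odd_double.
have [j v_j] : exists j, v = j.*2.+2 :> nat.
  move: v_even v_neq0; rewrite dvdn2; case: (vertexP v) => [|i|j] //=.
    by rewrite odd_double.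
  by exists j.
subst n; rewrite (ecc_folded _ _ _ v_j).
have j_le : j <= m by have := ltn_ord v; rewrite v_j !ltnS leq_double.
have -> : (m.*2.+3 + 1)./2 = m.+2 by rewrite addn1 -!doubleS doubleK.
have -> : (v : nat)./2 + 1 = j.+2 by rewrite v_j -doubleS doubleK addn1.
have -> : (m.*2.+3 - v + 3)./2 = (m - j).+2.
  rewrite v_j !subSS subSn ?leq_double // -doubleB addn3 -!doubleS.
  exact: doubleK.
(* The threshold [m.+2 <= j.*2.+2] amounts to [m - j <= j], the very comparison that decides
   [maxn j (m - j)]. *)
rewrite v_j !ltnS -addnn -leq_subLR.
by case: leqP.
Qed.
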